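(* Let $G$ be a finite connected graph which either has at least three vertices, or has at least two vertices and at least one loop. Let $H$ be a finite connected graph on at least two vertices with at least one loop. Then the direct product $G\times H$ is a median graph if and only if there are integers $k\geq 3$ and $l\geq 2$ such that $G$ is (isomorphic to) the path $P_k$ and $H$ is (isomorphic to) the path $P_l$ with exactly one loop added, at an end vertex.
   Context: Graphs are undirected, without multiple edges, and may have loops (at most one at each vertex). A vertex $x$ has a loop when $x\sim x$, where $\sim$ denotes adjacency. $P_n$ denotes the (loopless) path on $n$ vertices. The direct product $G\times H$ has vertex set $V(G)\times V(H)$, with $(v_1,h_1)\sim(v_2,h_2)$ if and only if $v_1\sim v_2$ in $G$ and $h_1\sim h_2$ in $H$ (loops count as adjacency of a vertex with itself). The distance $d(x,y)$ is the length of a shortest path from $x$ to $y$. A median graph is a connected graph in which for every three vertices $u,v,w$ there exists a unique vertex $m$ (the median) lying on a geodesic (shortest path) between each two of them, i.e. $d(a,m)+d(m,b)=d(a,b)$ for each pair $a,b$ among $u,v,w$. *)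

(* Defs.v *)
From HB Require Import structures.
From mathcomp Require Import all_boot.

Set Implicit Arguments.
Unset Strict Implicit.
Unset Printing Implicit Defensive.

(* Since [adj] need not be irreflexive, loops are allowed: x has a loop when
   [adj x x]. *)
Record graph := Graph {
  vertex :> finType;
  adj : rel vertex;
  adj_sym : symmetric adj
}.

Definition has_loop (G : graph) : Prop := exists x : G, adj x x.

Definition connected (G : graph) : Prop := forall x y : G, connect (@adj G) x y.

Definition isomorphic (G H : graph) : Prop :=
  exists2 f : G -> H, bijective f & forall x y : G, adj (f x) (f y) = adj x y.

Definition has_path (G : graph) (x y : G) (n : nat) : bool :=
  [exists p : n.-tuple G,
     [&& path (@adj G) x p, last x p == y & uniq (x :: p)]].

(* A path has fewer than #|G| edges, so this is the length of a shortest path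
   whenever there is one; otherwise it takes the junk value #|G|. *)
Definition dist (G : graph) (x y : G) : nat :=
  find (has_path x y) (iota 0 #|G|).

Definition between (G : graph) (a m b : G) : Prop :=
  dist a m + dist m b = dist a b.

Definition is_median (G : graph) (u v w m : G) : Prop :=
  [/\ between u m v, between v m w & between u m w].

Definition median_graph (G : graph) : Prop :=
  connected G /\ forall u v w : G, exists! m : G, is_median u v w m.

Definition direct_adj (G H : graph) : rel (G * H)%type :=
  fun a b => adj a.1 b.1 && adj a.2 b.2.

Lemma direct_adj_sym (G H : graph) : symmetric (@direct_adj G H).
Proof. by move=> a b; rewrite /direct_adj adj_sym [adj a.2 _]adj_sym. Qed.

Definition direct_product (G H : graph) : graph := Graph (@direct_adj_sym G H).

Definition path_adj (n : nat) : rel 'I_n :=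
  fun i j => (i.+1 == j :> nat) || (j.+1 == i :> nat).

Lemma path_adj_sym n : symmetric (@path_adj n).
Proof. by move=> i j; rewrite /path_adj orbC. Qed.

Definition path_graph (n : nat) : graph := Graph (@path_adj_sym n).

Definition looped_path_adj (n : nat) : rel 'I_n :=
  fun i j => path_adj i j || ((i == 0 :> nat) && (j == 0 :> nat)).

Lemma looped_path_adj_sym n : symmetric (@looped_path_adj n).
Proof. by move=> i j; rewrite /looped_path_adj path_adj_sym andbC. Qed.

(* The path on n vertices with a single loop, added at the end vertex 0. *)
Definition looped_path_graph (n : nat) : graph := Graph (@looped_path_adj_sym n).

(* Main.v *)
Require Import Defs.
From mathcomp Require Import all_boot.
From mathcomp Require Import zify.

Set Implicit Arguments.
Unset Strict Implicit.
Unset Printing Implicit Defensive.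

(** Suppose that [G x H] is median.  Two facts about median graphs do all the
    work: two adjacent vertices are never equidistant from a third one
    ([median_adj_dist_neq]), and two neighbours of a vertex that are
    equidistant from [u] have a common neighbour one step nearer to [u]
    ([median_quadrangle]).  It follows that a loopless median graph has no
    K(2,3) ([median_no_K23]).

    A loop in [G] would give a triangle in the product, so [G] is loopless.
    The edge between a looped vertex [h] of [H] and a neighbour of [h], and a
    vertex of [G] with two neighbours, turn a vertex with three neighbours in
    either factor, or two vertices with two common neighbours, into a K(2,3)
    of the product.  Thus both factors have maximum degree two, where a loop
    counts once, and in neither of them do two vertices have two common
    neighbours.  In [H] the vertex [h] then has a
    single neighbour other than itself, so [H] is a path that starts at [h]
    ([dist_injective]).  In [G] it remains to exclude cycles, and in [H] a
    second loop; the quadrangle property does both.  If [x] and [y] are two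
    neighbours of [g] nearer to [u] than [g], they have a common neighbour
    nearer to [u] still, hence different from [g], which is impossible
    ([left_unique_pred]).  A second loop, at [e], behaves in the same way,
    because [e] and its predecessor on the way from [h] are both reached from
    [h] by walks of length [dist h e], the second one by using the loop at [h]
    ([right_loop_unique]).

    Conversely, reflecting the looped path with [l] vertices in its loop gives
    the path with [2 l] vertices, and the product of a path with the looped
    path becomes one of the two components of the product of two paths.  Along
    the diagonals of this grid, distance is the taxicab distance on a lattice
    region bounded by four diagonal lines.  Such a region contains the
    coordinatewise median of any three of its points ([diamond_med3]). *)

(** * Walks and distance *)

(** Walks, unlike simple paths, project to and lift from the factors of a
    direct product with their lengths unchanged. *)
Fixpoint walk (G : graph) (n : nat) (x y : G) : Prop :=
  if n is n'.+1 then exists2 z, adj x z & walk n' z y else x = y.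

Lemma walk_path (G : graph) (x y : G) n :
  walk n x y <-> exists p, [/\ path (@adj G) x p, last x p = y & size p = n].
Proof.
elim: n x => [|n IHn] x /=.
  by split=> [<-|[p [_ <- /size0nil->]]] //; exists [::].
split=> [[z xz /IHn[p [zp zy sp]]]|[[|z p] [] //= /andP[xz zp] zy [sp]]].
  by exists (z :: p); rewrite /= xz sp.
by exists z => //; apply/IHn; exists p.
Qed.

Lemma walk_cat (G : graph) (x y z : G) m n :
  walk m x y -> walk n y z -> walk (m + n) x z.
Proof.
elim: m x => [|m IHm] x /= => [-> //|[t xt ty] yz].
by exists t => //; apply: IHm.
Qed.

Lemma walk_sym (G : graph) (x y : G) n : walk n x y -> walk n y x.
Proof.
elim: n x => [|n IHn] x => [-> //|[t xt /IHn yt]]; rewrite -addn1.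
by apply: walk_cat yt _; exists x; rewrite //= adj_sym.
Qed.

Lemma walk1 (G : graph) (x y : G) : walk 1 x y <-> adj x y.
Proof. by split=> [[z xz /= <-]|xy] //; exists y. Qed.

(** Shortening a walk to a simple path also keeps its length below the number
    of vertices, which is the range searched by [dist]. *)
Lemma walk_has_path (G : graph) (x y : G) n :
  walk n x y -> exists k, [/\ k <= n, k < #|G| & has_path x y k].
Proof.
case/walk_path=> p [xp <- <-]; case: (shortenP xp) => q xq uq sub_qp.
exists (size q); split; first by apply: uniq_leq_size => //; case/andP: uq.
  by rewrite -ltnS -[X in X < _]/(size (x :: q)) -(card_uniqP uq) ltnS max_card.
by apply/existsP; exists (in_tuple q); rewrite xq eqxx uq.
Qed.

Lemma dist_le (G : graph) (x y : G) n : walk n x y -> dist x y <= n.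
Proof.
case/walk_has_path=> k [le_kn lt_kG hk]; apply: leq_trans le_kn.
rewrite leqNgt; apply/negP=> /(before_find 0).
by rewrite nth_iota // add0n hk.
Qed.

Lemma walk_dist_of_walk (G : graph) (x y : G) n :
  walk n x y -> dist x y < #|G| /\ walk (dist x y) x y.
Proof.
case/walk_has_path=> k [_ lt_kG hk].
have hasp : has (has_path x y) (iota 0 #|G|).
  by apply/hasP; exists k; rewrite // mem_iota.
have lt_dG : dist x y < #|G| by rewrite -[X in _ < X](size_iota 0) -has_find.
split=> //; move: (nth_find 0 hasp); rewrite nth_iota // add0n.
case/existsP=> p /and3P[xp /eqP py _]; apply/walk_path.
by exists p; rewrite size_tuple.
Qed.

Lemma connected_walk (G : graph) (x y : G) : connected G -> exists n, walk n x y.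
Proof.
move=> connG; have /connectP[p xp ly] := connG x y.
by exists (size p); apply/walk_path; exists p.
Qed.

Lemma dist_lt_card (G : graph) (x y : G) : connected G -> dist x y < #|G|.
Proof. by case/(connected_walk x y)=> n /walk_dist_of_walk[]. Qed.

Lemma walk_dist (G : graph) (x y : G) : connected G -> walk (dist x y) x y.
Proof. by case/(connected_walk x y)=> n /walk_dist_of_walk[]. Qed.

Lemma distxx (G : graph) (x : G) : dist x x = 0.
Proof. by apply/eqP; rewrite -leqn0; apply: dist_le. Qed.

Lemma dist_eq0 (G : graph) (x y : G) : connected G -> dist x y = 0 -> x = y.
Proof. by move=> /(walk_dist x y) + d0; rewrite d0. Qed.

Lemma dist_sym (G : graph) (x y : G) : connected G -> dist x y = dist y x.
Proof.
move=> connG.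
by apply/anti_leq/andP; split; apply/dist_le/walk_sym/walk_dist.
Qed.

Lemma dist_triangle (G : graph) (x y z : G) :
  connected G -> dist x z <= dist x y + dist y z.
Proof. by move=> connG; apply: dist_le; apply: walk_cat; apply: walk_dist. Qed.

Lemma dist_adj_le1 (G : graph) (x y : G) : adj x y -> dist x y <= 1.
Proof. by move=> xy; apply/dist_le/walk1. Qed.

Lemma dist1_adj (G : graph) (x y : G) : connected G -> dist x y = 1 -> adj x y.
Proof. by move=> /(walk_dist x y) + d1; rewrite d1 => /walk1. Qed.

Lemma adj_dist1 (G : graph) (x y : G) :
  connected G -> adj x y -> x <> y -> dist x y = 1.
Proof.
move=> connG /dist_adj_le1 le1 ne_xy.
by apply/eqP; rewrite eqn_leq le1 lt0n; apply/eqP=> /(dist_eq0 connG).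
Qed.

Lemma dist_step (G : graph) (u x y : G) :
  connected G -> adj x y -> dist u y <= (dist u x).+1.
Proof.
move=> connG /dist_adj_le1 le1; rewrite -addn1.
by apply: leq_trans (dist_triangle u x y connG) _; rewrite leq_add2l.
Qed.

(** The last step of a geodesic from [u] to [x]. *)
Lemma dist_pred (G : graph) (u x : G) : connected G -> u <> x ->
  exists2 y, adj y x & dist u x = (dist u y).+1.
Proof.
move=> connG ne_ux.
case d_ux: (dist u x) => [|n]; first by case: ne_ux; apply: dist_eq0 d_ux.
have: walk n.+1 x u by apply: walk_sym; rewrite -d_ux; apply: walk_dist.
case=> y xy /walk_sym/dist_le le_n; exists y; first by rewrite adj_sym.
have := @dist_step _ u y x connG; rewrite adj_sym d_ux => /(_ xy); lia.
Qed.

Lemma connected_neighbour (G : graph) (x : G) :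
  connected G -> 2 <= #|G| -> exists2 y, adj x y & y <> x.
Proof.
move=> connG /card_gt1P[a [b [_ _ ne_ab]]].
have [c ne_cx] : exists c, c <> x.
  case: (eqVneq a x) ne_ab => [->|/eqP]; last by exists a.
  by rewrite eq_sym => /eqP; exists b.
have [y yx dx] := dist_pred connG ne_cx; exists y; first by rewrite adj_sym.
by move=> eyx; move: dx; rewrite eyx; lia.
Qed.

Lemma vertex_with_two_neighbours (G : graph) : connected G -> 3 <= #|G| ->
  exists v v1 v2 : G, [/\ adj v v1, adj v v2 & v1 <> v2].
Proof.
move=> connG /card_gt2P[a [b [c [_ [ab bc ca]]]]].
have far y : adj a y \/ y = a \/
    exists v v1 v2 : G, [/\ adj v v1, adj v v2 & v1 <> v2].
  case: (eqVneq a y) => [->|/eqP ne_ay]; first by right; left.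
  have [p py dy] := dist_pred connG ne_ay.
  case: (eqVneq a p) => [->|/eqP ne_ap]; first by left.
  have [q qp dp] := dist_pred connG ne_ap.
  right; right; exists p, y, q; split=> //; first by rewrite adj_sym.
  by move=> yq; move: dp; rewrite -yq dy; lia.
have [ab'|[ba|//]] := far b; last by rewrite ba eqxx in ab.
have [ac'|[ca'|//]] := far c; last by rewrite ca' eqxx in ca.
by exists a, b, c; split=> //; apply/eqP.
Qed.

(** * Paths recognised from one end *)

(** By induction on the distance from [r]: a vertex other than [r] spends one of
    its two neighbours on its predecessor, so only one is left for the next
    layer. *)
Lemma dist_injective (X : graph) (r : X) :
    connected X ->
    (forall x a b c : X, x <> r -> adj x a -> adj x b -> adj x c ->
       [\/ a = b, b = c | a = c]) ->
    (forall a b : X, adj r a -> adj r b -> a <> r -> b <> r -> a = b) ->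
  injective (dist r).
Proof.
move=> connX deg2 deg1 x y.
move: {2}(dist r x) (erefl (dist r x)) => n.
elim: n x y => [|n IHn] x y dx dy.
  by rewrite -(dist_eq0 connX dx) (dist_eq0 connX (etrans (esym dy) dx)).
have ne_rx : r <> x by move=> rx; move: dx; rewrite -rx distxx.
have ne_ry : r <> y by move=> ry; move: dx; rewrite dy -ry distxx.
have [p px dp] := dist_pred connX ne_rx.
have [q qy dq] := dist_pred connX ne_ry.
have epq : p = q by apply: IHn; lia.
rewrite -epq in qy dq; case: (eqVneq r p) => [rp|/eqP ne_rp].
  by rewrite -rp in px qy; apply: deg1 px qy _ _; apply/nesym.
have [o op dop] := dist_pred connX ne_rp.
rewrite adj_sym in op.
by case: (deg2 p o x y (nesym ne_rp) op px qy) => // e; move: dop; rewrite e; lia.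
Qed.

(** When distance from [r] separates the vertices, it numbers them
    consecutively, so only the position of the loops is left to decide. *)
Lemma isomorphic_by_distance (X : graph) (r : X) (e : rel 'I_#|X|)
    (e_sym : symmetric e) :
    connected X -> injective (dist r) ->
    (forall i j : 'I_#|X|, i <> j -> e i j = path_adj i j) ->
    (forall (x : X) (i : 'I_#|X|), i = dist r x :> nat -> e i i = adj x x) ->
  isomorphic X (Graph e_sym).
Proof.
move=> connX injd e_path e_loop.
pose f x := Ordinal (dist_lt_card r x connX).
have injf : injective f by move=> x y /(congr1 val) /injd.
exists f => [|x y]; first by apply: inj_card_bij => //; rewrite card_ord.
rewrite [LHS]/=; case: (eqVneq x y) => [<-|ne_xy]; first exact: e_loop.
rewrite e_path; last by move/injf=> exy; rewrite exy eqxx in ne_xy.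
have down a b : dist r b = (dist r a).+1 -> adj a b.
  move=> dab; have ne_rb : r <> b by move=> rb; move: dab; rewrite -rb distxx.
  by have [p pb dp] := dist_pred connX ne_rb; rewrite (_ : a = p) //; apply: injd; lia.
apply/idP/idP; rewrite /path_adj /=.
  by case/orP=> /eqP/esym/down //; rewrite adj_sym.
move=> xy; have := dist_step r connX xy; rewrite adj_sym in xy.
have := dist_step r connX xy.
by have : dist r x <> dist r y; [move/injd=> exy; rewrite exy eqxx in ne_xy | lia].
Qed.

(** * Median graphs *)

(** A median of [u], [x] and [y] must be [x] or [y], as these are adjacent, and
    then that one is the nearer to [u]. *)
Lemma median_adj_dist_neq (M : graph) (u x y : M) :
  median_graph M -> adj x y -> x <> y -> dist u x <> dist u y.
Proof.
move=> [connM med] xy ne_xy eq_d; have d1 := adj_dist1 connM xy ne_xy.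
have [m [[bux bxy buy] _]] := med u x y; rewrite /between in bux bxy buy.
have s1 := dist_sym x m connM.
have [dm|dm] : dist x m = 0 \/ dist m y = 0 by lia.
  by move/(dist_eq0 connM): dm => dm; rewrite -{}dm in bux bxy buy; lia.
by move/(dist_eq0 connM): dm => dm; rewrite {}dm in bux bxy buy s1; lia.
Qed.

Lemma median_dist2 (M : graph) (x y z : M) :
  median_graph M -> adj z x -> adj z y -> z <> x -> z <> y -> x <> y ->
  dist x y = 2.
Proof.
move=> med zx zy nzx nzy nxy; have connM := med.1.
have d0 : dist x y <> 0 by move/(dist_eq0 connM).
have d1 : dist x y <> 1.
  move/(dist1_adj connM)=> xy; apply: (@median_adj_dist_neq _ z x y med xy nxy).
  by rewrite !adj_dist1.
have := dist_triangle x z y connM.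
have := dist_adj_le1 zy; have := dist_adj_le1 zx; rewrite (dist_sym z x) //; lia.
Qed.

(** Here [x] and [y] are at distance two, so the median of [u], [x] and [y] is a
    common neighbour of [x] and [y]. *)
Lemma median_quadrangle (M : graph) (u x y z : M) :
    median_graph M -> x <> y -> adj z x -> adj z y ->
    z <> x -> z <> y -> dist u x = dist u y ->
  exists m, [/\ adj m x, adj m y & (dist u m).+1 = dist u x].
Proof.
move=> med nxy zx zy nzx nzy eq_d; have connM := med.1.
have d2 := median_dist2 med zx zy nzx nzy nxy.
have [m [[bux bxy buy] _]] := med.2 u x y; rewrite /between in bux bxy buy.
have sx := dist_sym x m connM.
by exists m; split; try apply: dist1_adj => //; lia.
Qed.

(** Both [p] and [q] are medians of [a], [b] and [c], which are pairwise at
    distance two. *)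
Lemma median_no_K23 (M : graph) (p q a b c : M) :
    median_graph M -> (forall x : M, ~~ adj x x) ->
    adj p a -> adj p b -> adj p c -> adj q a -> adj q b -> adj q c ->
    a <> b -> b <> c -> a <> c ->
  p = q.
Proof.
move=> med loopless pa pb pc qa qb qc nab nbc nac; have connM := med.1.
have adj_neq (x y : M) : adj x y -> x <> y.
  by move=> xy e; rewrite e (negPf (loopless y)) in xy.
have centre r : adj r a -> adj r b -> adj r c -> is_median a b c r.
  move=> ra rb rc; have adj1 y : adj r y -> dist r y = 1 /\ dist y r = 1.
    by move=> ry; rewrite (dist_sym y) // adj_dist1 //; apply: adj_neq.
  have d2 x y : adj r x -> adj r y -> x <> y -> dist x y = 2.
    by move=> rx ry; apply: (@median_dist2 _ x y r) => //; apply: adj_neq.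
  split; rewrite /between.
  - by rewrite (d2 a b) // (adj1 a ra).2 (adj1 b rb).1.
  - by rewrite (d2 b c) // (adj1 b rb).2 (adj1 c rc).1.
  - by rewrite (d2 a c) // (adj1 a ra).2 (adj1 c rc).1.
have [m [_ uniq_m]] := med.2 a b c.
by rewrite -(uniq_m p) ?(uniq_m q) //; apply: centre.
Qed.

(** * Median direct products *)

Lemma walk_direct_product (G H : graph) n (u v : direct_product G H) :
  walk n u v <-> walk n u.1 v.1 /\ walk n u.2 v.2.
Proof.
elim: n u => [|n IHn] u /=.
  by case: u v => [a b] [c d] /=; split=> [[-> ->]|[-> ->]].
split=> [[z /andP[uz1 uz2] /IHn[]]|[[a ua av] [b ub bv]]].
  by split; [exists z.1 | exists z.2].
by exists (a, b); [apply/andP | apply/IHn].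
Qed.

Lemma dist_fst_le (G H : graph) (u v : direct_product G H) :
  connected (direct_product G H) -> dist u.1 v.1 <= dist u v.
Proof. by move=> /(walk_dist u v)/walk_direct_product[/dist_le]. Qed.

Lemma dist_snd_le (G H : graph) (u v : direct_product G H) :
  connected (direct_product G H) -> dist u.2 v.2 <= dist u v.
Proof. by move=> /(walk_dist u v)/walk_direct_product[_ /dist_le]. Qed.

(** The loop at [h] lets the second coordinate stand still, so the layer at [h]
    is an isometric copy of [G]. *)
Lemma dist_loop_layer (G H : graph) (a b : G) (h : H) :
    connected G -> connected (direct_product G H) -> adj h h ->
  @dist (direct_product G H) (a, h) (b, h) = dist a b.
Proof.
move=> connG connP hh; apply/anti_leq/andP; split.
  apply/dist_le/walk_direct_product; split; first exact: walk_dist.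
  by elim: (dist a b) => //= n IHn; exists h.
exact: (@dist_fst_le G H (a, h) (b, h)).
Qed.

(** A loop at [g], the loop at [h] and edges [g g'] and [h h'] make [(g, h)],
    [(g', h)] and [(g, h')] a triangle. *)
Lemma loopless_left_factor (G H : graph) :
    connected G -> 2 <= #|G| -> connected H -> 2 <= #|H| -> has_loop H ->
    median_graph (direct_product G H) ->
  forall g : G, ~~ adj g g.
Proof.
move=> connG sizeG connH sizeH [h hh] med g; apply/negP=> gg.
have [g' gg' ng] := connected_neighbour g connG sizeG.
have [h' hh' nh] := connected_neighbour h connH sizeH.
have g'g : adj g' g by rewrite adj_sym.
pose P := direct_product G H.
pose u : P := (g', h); pose x : P := (g, h); pose y : P := (g, h').
have xy : adj x y by apply/andP.
have ux : adj u x by apply/andP.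
have uy : adj u y by apply/andP.
apply: (@median_adj_dist_neq P u x y) => //; first by case=> /esym.
by rewrite !adj_dist1 //; try exact: med.1; case.
Qed.

(** * The factors of a median product *)

Section MedianFactors.

Variables G H : graph.
Hypotheses (connG : connected G) (connH : connected H).
Hypotheses (sizeG : 3 <= #|G|) (sizeH : 2 <= #|H|).
Hypothesis loopless : forall g : G, ~~ adj g g.
Hypothesis med : median_graph (direct_product G H).
Variable h : H.
Hypothesis hh : adj h h.

Local Notation P := (direct_product G H).

Lemma product_no_K23 (p q a b c : P) :
    adj p a -> adj p b -> adj p c -> adj q a -> adj q b -> adj q c ->
    a <> b -> b <> c -> a <> c -> p = q.
Proof.
apply: (@median_no_K23 P) => // x; apply/negP=> /andP[x1 _].
by rewrite (negPf (loopless _)) in x1.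
Qed.

Lemma left_adj_neq (x y : G) : adj x y -> x <> y.
Proof. by move=> + e; rewrite e (negPf (loopless y)). Qed.

(** The K(2,3) has the centres [(x, h)] and [(x, h')] over three neighbours of [x]
    in the layer of [h]. *)
Lemma left_degree_le2 (x a b c : G) :
  adj x a -> adj x b -> adj x c -> [\/ a = b, b = c | a = c].
Proof.
move=> xa xb xc; have [h' hh' nh] := connected_neighbour h connH sizeH.
have [|/eqP nab] := eqVneq a b; first by constructor 1.
have [|/eqP nbc] := eqVneq b c; first by constructor 2.
have [|/eqP nac] := eqVneq a c; first by constructor 3.
rewrite adj_sym in hh'.
case: nh; have [//] : (x, h') = (x, h).
by apply: (@product_no_K23 (x, h') (x, h) (a, h) (b, h) (c, h));
  rewrite /= /direct_adj /= ?xa ?xb ?xc //; case.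
Qed.

(** Here [(x, h)] and [(y, h)] are the centres; the third leaf [(a, h')] comes from
    the edge [h h']. *)
Lemma left_common_neighbour (x y a b : G) :
  x <> y -> adj a x -> adj a y -> adj b x -> adj b y -> a = b.
Proof.
move=> nxy ax ay bx by_; have [h' hh' nh] := connected_neighbour h connH sizeH.
have [//|/eqP nab] := eqVneq a b.
case: nxy; have [//] : (x, h) = (y, h).
by apply: (@product_no_K23 (x, h) (y, h) (a, h) (b, h) (a, h'));
  rewrite /= /direct_adj /= ?hh ?hh' ?[adj x _]adj_sym ?[adj y _]adj_sym ?ax ?ay ?bx ?by_ //;
  case=> *; auto.
Qed.

(** The centres are [(v1, x)] and [(v2, x)], with [v1] and [v2] neighbours of [v], and
    the leaves lie over [v]. *)
Lemma right_degree_le2 (x a b c : H) :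
  adj x a -> adj x b -> adj x c -> [\/ a = b, b = c | a = c].
Proof.
move=> xa xb xc.
have [v [v1 [v2 [vv1 vv2 nv]]]] := vertex_with_two_neighbours connG sizeG.
have [|/eqP nab] := eqVneq a b; first by constructor 1.
have [|/eqP nbc] := eqVneq b c; first by constructor 2.
have [|/eqP nac] := eqVneq a c; first by constructor 3.
rewrite adj_sym in vv1; rewrite adj_sym in vv2.
case: nv; have [//] : (v1, x) = (v2, x).
by apply: (@product_no_K23 (v1, x) (v2, x) (v, a) (v, b) (v, c));
  rewrite /= /direct_adj /= ?xa ?xb ?xc ?vv1 ?vv2 //; case.
Qed.

Lemma right_common_neighbour (x y a b : H) :
  x <> y -> adj a x -> adj a y -> adj b x -> adj b y -> a = b.
Proof.
move=> nxy ax ay bx by_.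
have [v [v1 [v2 [vv1 vv2 nv]]]] := vertex_with_two_neighbours connG sizeG.
have [//|/eqP nab] := eqVneq a b.
case: nxy; have [//] : (v, x) = (v, y).
by apply: (@product_no_K23 (v, x) (v, y) (v1, a) (v2, a) (v1, b));
  rewrite /= /direct_adj /= ?vv1 ?vv2 ?[adj x _]adj_sym ?[adj y _]adj_sym ?ax ?ay ?bx ?by_ //;
  case=> *; auto.
Qed.

Lemma left_dist_adj_neq (u x y : G) : adj x y -> dist u x <> dist u y.
Proof.
move=> xy; rewrite -!(@dist_loop_layer G H _ _ h) //; try exact: med.1.
apply: (@median_adj_dist_neq P) => //; first by apply/andP.
by case; apply: left_adj_neq.
Qed.

(** Otherwise the quadrangle property, applied in the layer of [h], yields a
    common neighbour of [x] and [y] nearer to [u] than [g], although [g] is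
    their only common neighbour. *)
Lemma left_unique_pred (u g x y : G) :
    adj g x -> adj g y -> dist u g = (dist u x).+1 -> dist u g = (dist u y).+1 ->
  x = y.
Proof.
move=> gx gy dx dy; have [//|/eqP nxy] := eqVneq x y.
have layer := @dist_loop_layer G H u _ h connG med.1 hh.
have ngx := left_adj_neq gx; have ngy := left_adj_neq gy.
have [||||||m [/andP[/= mx _] /andP[/= my _] dm]] :=
  @median_quadrangle P (u, h) (x, h) (y, h) (g, h) med; try by case.
- exact/andP.
- exact/andP.
- by rewrite !layer; lia.
have gm : g = m.1 by apply: left_common_neighbour mx my.
have := @dist_fst_le G H (u, h) m med.1; rewrite /= -gm.
by move: dm; rewrite layer; lia.
Qed.

(** The root is an end [a] of a diameter [a b].  All neighbours of [a] are nearer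
    to [b] than [a] is, so there is only one. *)
Lemma left_path : isomorphic G (path_graph #|G|).
Proof.
have /card_gt0P[g0 _] : 0 < #|G| by lia.
have [[a b] _ max_ab] := @arg_maxnP (G * G)%type (g0, g0) predT (fun p => dist p.1 p.2) isT.
have {}max_ab x y : dist x y <= dist a b := max_ab (x, y) isT.
have injd : injective (dist a).
  apply: dist_injective => // [x x1 x2 x3 _|c c' ac ac' _ _]; first exact: left_degree_le2.
  have dS x : adj a x -> dist b a = (dist b x).+1.
    move=> ax; have := max_ab b x; have := @left_dist_adj_neq b a x ax.
    rewrite adj_sym in ax; have := dist_step b connG ax.
    by rewrite (dist_sym a b) //; lia.
  exact: left_unique_pred ac ac' (dS _ ac) (dS _ ac').
apply: isomorphic_by_distance injd _ _ => // x i _.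
by rewrite (negPf (loopless x)) /path_adj; lia.
Qed.

(** With [e'] the predecessor of [e], the vertices [x = (w, e)] and [y = (w, e')]
    are both adjacent to [z = (v, e)], for any neighbour [v] of [w], and both at
    distance [dist h e] from [u = (w0, h)], where [w0] is joined to [w] by a walk
    of that length.  The second coordinate of the common neighbour of [x] and [y]
    nearer to [u] is adjacent to [e] and [e'], so it is [e], which is too far
    from [h]. *)
Lemma right_loop_unique (e : H) : adj e e -> e = h.
Proof.
move=> ee; have [//|/eqP nhe] := eqVneq h e.
have [e' e'e de] := dist_pred connH nhe.
have ne : e <> e' by move=> ee'; move: de; rewrite -ee'; lia.
have /card_gt0P[w _] : 0 < #|G| by lia.
have [v wv nvw] := connected_neighbour w connG (ltnW sizeG).
(* Going back and forth along the edge [w v] gives walks of any length. *)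
have [w0 w0w] : exists w0, walk (dist h e) w0 w.
  move: (dist h e) => n; suff: exists w0, walk n w w0 by case=> w0 /walk_sym; exists w0.
  elim: n w v wv {nvw} => [|n IHn] x y xy; first by exists x.
  by have [|z yz] := IHn y x; [rewrite adj_sym | exists z, y].
have connP := med.1.
pose u : P := (w0, h); pose x : P := (w, e); pose y : P := (w, e').
pose z : P := (v, e); rewrite adj_sym in wv; rewrite adj_sym in e'e.
have zx : adj z x by apply/andP.
have zy : adj z y by apply/andP.
have nzx : z <> x by case.
have nzy : z <> y by case.
have nxy : x <> y by case.
have dx : dist u x = dist h e.
  apply/anti_leq/andP; split; last exact: (@dist_snd_le G H u x).
  by apply/dist_le/walk_direct_product; split=> //; apply: walk_dist.
have dz := @dist_snd_le G H u z connP; rewrite /= in dz.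
have ndz := @median_adj_dist_neq P u z x med zx nzx.
have dy : dist u y = dist h e.
  (* [z] is at distance [dist h e + 1], so [y] is not nearer than [dist h e]; a
     walk of that length waits once at [h], then goes to [e']. *)
  have yz : adj y z by rewrite adj_sym.
  have := @dist_step P u y z connP yz.
  suff: dist u y <= dist h e by lia.
  apply/dist_le/walk_direct_product; split=> //=.
  by rewrite de; exists h => //; apply: walk_dist.
have [m [/andP[_ /= mx] /andP[_ /= my] dm]] :=
  @median_quadrangle P u x y z med nxy zx zy nzx nzy (etrans dx (esym dy)).
have em : e = m.2 by apply: right_common_neighbour mx my.
have := @dist_snd_le G H u m connP; rewrite /= -em; lia.
Qed.

Lemma right_looped_path : isomorphic H (looped_path_graph #|H|).
Proof.
have injd : injective (dist h).
  apply: dist_injective => // [x x1 x2 x3 _|a b ha hb nah nbh]; first exact: right_degree_le2.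
  by case: (right_degree_le2 ha hb hh).
apply: isomorphic_by_distance injd _ _ => // [i j|x i ix].
  move=> nij; have {}nij : i <> j :> nat by move/val_inj.
  by rewrite /looped_path_adj /path_adj; lia.
rewrite /looped_path_adj /path_adj ix.
have [xx|/negPf xx] := boolP (adj x x).
  by rewrite (right_loop_unique xx) distxx.
have := @dist_eq0 _ h x connH; case: (dist h x) => [/(_ erefl) hx|n _]; last by lia.
by rewrite -hx hh in xx.
Qed.

End MedianFactors.

(** * Taxicab distance on lattice regions *)

Definition gap (a b : nat) : nat := (a - b) + (b - a).

Definition taxi (s t s' t' : nat) : nat := gap s s' + gap t t'.

(** In the coordinates [a = s + t - l] and [c = s - t + l], this is the rectangle
    [0 <= a < k], [0 <= c < 2 l]. *)
Definition diamond (k l s t : nat) : bool :=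
  [&& l <= s + t, s + t < l + k, t <= s + l & s < t + l].

Definition med3 (a b c : nat) : nat := maxn (minn a b) (minn (maxn a b) c).

Lemma gap_triangle a b c : gap a c <= gap a b + gap b c.
Proof. rewrite /gap; lia. Qed.

Lemma gap_between a m b :
  (gap a m + gap m b == gap a b) = (minn a b <= m <= maxn a b).
Proof. rewrite /gap; lia. Qed.

Lemma med3_between a b c : let m := med3 a b c in
  [/\ minn a b <= m <= maxn a b, minn b c <= m <= maxn b c
    & minn a c <= m <= maxn a c].
Proof. rewrite /med3 /=; split; lia. Qed.

Lemma med3_unique a b c m :
  minn a b <= m <= maxn a b -> minn b c <= m <= maxn b c ->
  minn a c <= m <= maxn a c -> m = med3 a b c.
Proof. rewrite /med3; lia. Qed.

Lemma taxi_between s1 t1 s t s2 t2 :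
  (taxi s1 t1 s t + taxi s t s2 t2 == taxi s1 t1 s2 t2) =
  (minn s1 s2 <= s <= maxn s1 s2) && (minn t1 t2 <= t <= maxn t1 t2).
Proof.
rewrite -!gap_between /taxi; have := gap_triangle s1 s s2.
have := gap_triangle t1 t t2; lia.
Qed.

(** Each constraint involves two coordinates only: for each of the two, at least
    two of the three points lie on the right side of the median, so one point
    does for both and passes its inequality on to the median. *)
Lemma diamond_med3 k l s1 t1 s2 t2 s3 t3 :
  diamond k l s1 t1 -> diamond k l s2 t2 -> diamond k l s3 t3 ->
  diamond k l (med3 s1 s2 s3) (med3 t1 t2 t3).
Proof. rewrite /diamond /med3; lia. Qed.

(** A step towards the target in one of the coordinates stays in the region: if
    both have to change and one of them is blocked by a side, the other is not,
    since [k] and [l] are at least two. *)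
Lemma diamond_step k l s t s' t' : 2 <= k -> 2 <= l ->
    diamond k l s t -> diamond k l s' t' -> (s, t) <> (s', t') ->
  exists s1 t1, [/\ diamond k l s1 t1, taxi s t s1 t1 = 1
                  & taxi s t s' t' = (taxi s1 t1 s' t').+1].
Proof.
move=> k2 l2 D D' ne.
have try_step s1 t1 : [&& diamond k l s1 t1, taxi s t s1 t1 == 1
      & taxi s t s' t' == (taxi s1 t1 s' t').+1] ->
    exists s1 t1, [/\ diamond k l s1 t1, taxi s t s1 t1 = 1
                    & taxi s t s' t' = (taxi s1 t1 s' t').+1].
  by case/and3P=> D1 /eqP d1 /eqP dS; exists s1, t1.
suff [c|c|c|c] : [\/ [&& diamond k l s.+1 t & s < s'], [&& diamond k l s.-1 t & s' < s],
  [&& diamond k l s t.+1 & t < t'] | [&& diamond k l s t.-1 & t' < t]].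
- by apply: (try_step s.+1 t); move: c; rewrite /taxi /gap; lia.
- by apply: (try_step s.-1 t); move: c; rewrite /taxi /gap; lia.
- by apply: (try_step s t.+1); move: c; rewrite /taxi /gap; lia.
- by apply: (try_step s t.-1); move: c; rewrite /taxi /gap; lia.
have {}ne : s <> s' \/ t <> t'.
  by have [es|/eqP] := eqVneq s s'; [right=> et; case: ne; rewrite es et | left].
rewrite /diamond in D D' *; apply/or4P; lia.
Qed.

(** The bound along edges makes [D x] a lower bound for the length of every walk
    from [x] to [y], and repeated descent is a walk of exactly that length. *)
Lemma dist_of_descent (G : graph) (y : G) (D : G -> nat) :
    (forall x, D x = 0 -> x = y) -> D y = 0 ->
    (forall x x', adj x x' -> D x <= (D x').+1) ->
    (forall x, x <> y -> exists2 x', adj x x' & D x = (D x').+1) ->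
  forall x, connect (@adj G) x y /\ dist x y = D x.
Proof.
move=> D0 Dy Dadj Dstep x.
have lower n z : walk n z y -> D z <= n.
  elim: n z => [|n IHn] z /=; first by move=> ->; rewrite Dy.
  by case=> z' /Dadj le_z /IHn; lia.
have wD : walk (D x) x y.
  move: {-1}(D x) (erefl (D x)) => n; elim: n x => [|n IHn] x Dx; first exact: D0.
  have [x' xx' Dx'] : exists2 x', adj x x' & D x = (D x').+1.
    by apply: Dstep => xy; rewrite xy Dy in Dx.
  by exists x' => //; apply: IHn; lia.
have [p [xp py _]] := (walk_path _ _ _).1 wD.
split; first by apply/connectP; exists p.
apply/anti_leq/andP; split; first exact: dist_le.
by apply: lower; case: (walk_dist_of_walk wD).
Qed.

Lemma diamond_median (X : graph) (s t : X -> nat) k l :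
    2 <= k -> 2 <= l ->
    (forall x, diamond k l (s x) (t x)) ->
    (forall x y, s x = s y -> t x = t y -> x = y) ->
    (forall a b, diamond k l a b -> exists2 x, s x = a & t x = b) ->
    (forall x y, adj x y = (taxi (s x) (t x) (s y) (t y) == 1)) ->
  median_graph X.
Proof.
move=> k2 l2 inD inj surj adjE.
have distE x y : connect (@adj X) x y /\ dist x y = taxi (s x) (t x) (s y) (t y).
  apply: (@dist_of_descent X y (fun x => taxi (s x) (t x) (s y) (t y))) => {x} [x|||x ne].
  - by rewrite /taxi /gap => d0; apply: inj; lia.
  - by rewrite /taxi /gap; lia.
  - by move=> x x'; rewrite adjE /taxi /gap; lia.
  have [|a [b [Dab d1 dS]]] := diamond_step k2 l2 (inD x) (inD y).
    by case=> *; apply/ne/inj.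
  by have [x' ea eb] := surj _ _ Dab; exists x'; rewrite ?adjE ea eb // d1.
have betweenE x m y : between x m y <->
    (minn (s x) (s y) <= s m <= maxn (s x) (s y)) &&
    (minn (t x) (t y) <= t m <= maxn (t x) (t y)).
  by rewrite -taxi_between /between !(distE _ _).2; split=> /eqP.
split=> [x y|u v w]; first by have [] := distE x y.
have [m sm tm] := surj _ _ (diamond_med3 (inD u) (inD v) (inD w)).
exists m; split.
  have [s1 s2 s3] := med3_between (s u) (s v) (s w).
  have [t1 t2 t3] := med3_between (t u) (t v) (t w).
  by split; apply/betweenE; rewrite sm tm; apply/andP.
move=> m' [/betweenE/andP[s1 t1] /betweenE/andP[s2 t2] /betweenE/andP[s3 t3]].
by apply: inj; rewrite ?sm ?tm; apply/esym/med3_unique.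
Qed.

(** * The product of a path and a looped path *)

(** The looped path is the quotient of the path with [2 l] vertices by its
    reflection: the vertex [b] has the two lifts [l + b] and [l.-1 - b].  They
    have opposite parities, and the one with the parity of [a] is chosen, so
    that all pairs [(a, unfold l a b)] lie in the same component of the product
    of two paths. *)
Definition unfold (l a b : nat) : nat :=
  if odd (a + l + b) then l.-1 - b else l + b.

Lemma unfoldP l a b : b < l ->
  (unfold l a b = l + b /\ ~~ odd (a + l + b)) \/
  (unfold l a b + b = l.-1 /\ odd (a + l + b)).
Proof. by rewrite /unfold; case: ifP => _ lt_bl; [right | left]; lia. Qed.

Lemma path_product_median (G H : graph) k l : 2 <= k -> 2 <= l ->
  isomorphic G (path_graph k) -> isomorphic H (looped_path_graph l) ->
  median_graph (direct_product G H).
Proof.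
move=> k2 l2 [f [f' fK f'K] fadj] [g [g' gK g'K] gadj].
pose a (x : direct_product G H) : nat := f x.1.
pose b (x : direct_product G H) : nat := g x.2.
have lta x : a x < k := ltn_ord _.
have ltb x : b x < l := ltn_ord _.
(* The two diagonal directions; adding [l.*2] keeps [t] nonnegative. *)
pose s x := (a x + unfold l (a x) (b x))./2.
pose t x := (a x + l.*2 - unfold l (a x) (b x))./2.
have stE x : s x + t x = a x + l /\ s x + l = t x + unfold l (a x) (b x).
  by rewrite /s /t; have := unfoldP (a x) (ltb x); have := ltb x; lia.
have ltu x : unfold l (a x) (b x) < l.*2.
  by have := unfoldP (a x) (ltb x); have := ltb x; lia.
apply: (@diamond_median _ s t k l) => // [x|x y es et|c d Dcd|x y].
- by have := stE x; have := lta x; have := ltu x; rewrite /diamond; lia.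
- have [ea eb] : a x = a y /\ b x = b y.
    have ea : a x = a y by have := stE x; have := stE y; rewrite es et; lia.
    have := unfoldP (a x) (ltb x); have := unfoldP (a y) (ltb y).
    by have := stE x; have := stE y; rewrite es et ea; lia.
  rewrite [x]surjective_pairing [y]surjective_pairing.
  by rewrite -(fK x.1) -(gK x.2) (val_inj ea) (val_inj eb) fK gK.
- have [A ltA eA] : exists2 A, A < k & A + l = c + d.
    by exists (c + d - l); move: Dcd; rewrite /diamond; lia.
  have [B ltB eB] : exists2 B, B < l & (c + l - d = l + B \/ c + l - d + B = l.-1).
    have [lt_l|ge_l] := ltnP (c + l - d) l;
    [exists (l.-1 - (c + l - d)) | exists (c - d)];
    by move: Dcd; rewrite /diamond; lia.
  exists (f' (Ordinal ltA), g' (Ordinal ltB));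
  rewrite /s /t /a /b /= f'K g'K /=; have := unfoldP A ltB;
  by move: Dcd; rewrite /diamond; lia.
rewrite [LHS]/= /direct_adj -fadj -gadj /= /looped_path_adj /path_adj.
rewrite -/(a x) -/(a y) -/(b x) -/(b y) /taxi /gap.
have := unfoldP (a x) (ltb x); have := unfoldP (a y) (ltb y).
have := stE x; have := stE y; lia.
Qed.

Theorem theorem4p6 (G H : graph)
    (G_connected : connected G)
    (G_size : 3 <= #|G| \/ (2 <= #|G| /\ has_loop G))
    (H_connected : connected H)
    (H_size : 2 <= #|H|)
    (H_loop : has_loop H) :
  median_graph (direct_product G H) <->
  exists k l : nat,
    [/\ 3 <= k, 2 <= l, isomorphic G (path_graph k)
      & isomorphic H (looped_path_graph l)].
Proof.
split=> [med|[k [l [k3 l2 isoG isoH]]]]; last first.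
  exact: path_product_median (ltnW k3) l2 isoG isoH.
have G_size2 : 2 <= #|G| by case: G_size => [|[]] //; lia.
have loopless := loopless_left_factor G_connected G_size2 H_connected H_size H_loop med.
have {}G_size : 3 <= #|G|.
  by case: G_size => // [[_ [g gg]]]; rewrite (negPf (loopless g)) in gg.
have [h hh] := H_loop.
exists #|G|, #|H|; split=> //; first exact: left_path med _ hh.
exact: right_looped_path med _ hh.
Qed.
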